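(* For any fixed integer $m\ge 3$, as $n\to\infty$, \[ \tilde r(m,n)=O_m\left(\frac{n^m}{(\log n)^{\lfloor m/2\rfloor-1}}\right). \]
   Context: The $(m,n)$-online Ramsey game is played by two players, Builder and Painter, on an infinite set of initially isolated vertices. Each turn, Builder places an edge between two nonadjacent vertices and Painter immediately paints it red or blue. The online Ramsey number $\tilde r(m,n)$ is the smallest number of turns within which Builder can guarantee the existence of either a red $K_m$ or a blue $K_n$, whatever Painter does. Logarithms are natural; the implicit constant in $O_m$ depends only on $m$. *)

(* Defs.v *)
From mathcomp Require Import all_boot.
From mathcomp Require Import boolp.
From mathcomp Require Import zify.

Set Implicit Arguments.
Unset Strict Implicit.
Unset Printing Implicit Defensive.

(* The vertex set is nat.  A board is the history of the game: the coloured
   edges in the order in which they were placed, true being red and false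
   blue.  The edge {x, y} may be recorded as (x, y) or as (y, x). *)
Definition edge : Type := (nat * nat)%type.
Definition board : Type := seq (edge * bool).

Definition has_edge (c : bool) (b : board) (x y : nat) : bool :=
  (((x, y), c) \in b) || (((y, x), c) \in b).

Definition adjacent (b : board) (x y : nat) : bool :=
  has_edge true b x y || has_edge false b x y.

Definition legal_move (b : board) (e : edge) : bool :=
  (e.1 != e.2) && ~~ adjacent b e.1 e.2.

Definition has_clique (c : bool) (k : nat) (b : board) : Prop :=
  exists s : seq nat,
    [/\ uniq s, size s = k & {in s &, forall x y, x != y -> has_edge c b x y}].

Definition builder : Type := board -> edge.

(* A legal move exists on every board, since boards are finite; so legality is
   demanded on all boards rather than only on those reachable in play. *)
Definition legal_builder (B : builder) : Prop :=
  forall b : board, legal_move b (B b).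

Definition painter : Type := board -> edge -> bool.

Fixpoint play (B : builder) (P : painter) (t : nat) : board :=
  if t is t'.+1 then
    let b := play B P t' in rcons b (B b, P b (B b))
  else [::].

Definition builder_won (m n : nat) (b : board) : Prop :=
  has_clique true m b \/ has_clique false n b.

Definition builder_guarantees (m n t : nat) : Prop :=
  exists2 B : builder, legal_builder B &
    forall P : painter,
      exists2 t' : nat, (t' <= t)%N & builder_won m n (play B P t').

(* The remaining facts, up to online_ramsey, show that Builder can force a win
   within a bounded number of turns, so that a least such number exists. *)

Lemma has_edgeC c b x y : has_edge c b x y = has_edge c b y x.
Proof. by rewrite /has_edge orbC. Qed.

Lemma finite_ramsey (m n : nat) : exists N : nat,
  forall (e : rel nat) (s : seq nat), symmetric e -> uniq s -> (N <= size s)%N ->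
    (exists s', [/\ uniq s', size s' = m, {subset s' <= s}
                  & {in s' &, forall x y, x != y -> e x y}]) \/
    (exists s', [/\ uniq s', size s' = n, {subset s' <= s}
                  & {in s' &, forall x y, x != y -> ~~ e x y}]).
Proof.
have [k] := ubnP (m + n); elim: k m n => [//|k IH] [|m] n lk.
  by exists 0 => e s _ _ _; left; exists [::].
case: n lk => [|n] lk; first by exists 0 => e s _ _ _; right; exists [::].
have [N1 H1] := IH m n.+1 ltac:(lia).
have [N2 H2] := IH m.+1 n ltac:(lia).
exists (N1 + N2).+1 => e [|v s] // se /= /andP[vs us] ls.
have := count_predC (e v) s; rewrite -!size_filter => szs.
have [l1|l1] := leqP N1 (size (filter (e v) s)).
- have [[s' [u' z' sub' cl]]|[s' [u' z' sub' cl]]] := H1 e _ se (filter_uniq _ us) l1.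
  + left; exists (v :: s'); split.
    * rewrite /= u' andbT; apply/negP => /sub'.
      by rewrite mem_filter (negPf vs) andbF.
    * by rewrite /= z'.
    * move=> x; rewrite !inE => /orP[->//|/sub'].
      by rewrite mem_filter => /andP[_ ->]; rewrite orbT.
    * move=> x y; rewrite !inE => /orP[/eqP->|xs] /orP[/eqP->|ys] xy.
      - by rewrite eqxx in xy.
      - by have := sub' _ ys; rewrite mem_filter => /andP[].
      - by rewrite se; have := sub' _ xs; rewrite mem_filter => /andP[].
      - exact: cl.
  + right; exists s'; split=> // x /sub'; rewrite mem_filter => /andP[_ xs].
    by rewrite inE xs orbT.
- have l2 : (N2 <= size (filter (predC (e v)) s))%N by lia.
  have [[s' [u' z' sub' cl]]|[s' [u' z' sub' cl]]] := H2 e _ se (filter_uniq _ us) l2.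
  + left; exists s'; split=> // x /sub'; rewrite mem_filter => /andP[_ xs].
    by rewrite inE xs orbT.
  + right; exists (v :: s'); split.
    * rewrite /= u' andbT; apply/negP => /sub'.
      by rewrite mem_filter (negPf vs) andbF.
    * by rewrite /= z'.
    * move=> x; rewrite !inE => /orP[->//|/sub'].
      by rewrite mem_filter => /andP[_ ->]; rewrite orbT.
    * move=> x y; rewrite !inE => /orP[/eqP->|xs] /orP[/eqP->|ys] xy.
      - by rewrite eqxx in xy.
      - by have := sub' _ ys; rewrite mem_filter => /andP[].
      - by rewrite se; have := sub' _ xs; rewrite mem_filter => /andP[].
      - exact: cl.
Qed.

Lemma legal_move_ex (b : board) : exists e : edge, legal_move b e.
Proof.
pose M := (\sum_(p <- b) (p.1.1 + p.1.2)).+1.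
have bd p : p \in b -> (p.1.1 + p.1.2 < M)%N.
  by move=> pb; rewrite ltnS (big_rem p) //= leq_addr.
exists (M, M.+1); rewrite /legal_move /= neq_ltn ltnSn /=.
by apply/negP => /orP[]/orP[]/bd /=; lia.
Qed.

Lemma builder_guarantees_ex (m n : nat) :
  exists t : nat, `[< builder_guarantees m n t >].
Proof.
have [N HN] := finite_ramsey m n.
pose s := iota 0 N; pose pairs := [seq (x, y) | x <- s, y <- s].
pose B b := if filter (legal_move b) pairs is e :: _ then e
            else xchoose (legal_move_ex b).
have BL : legal_builder B.
  move=> b; rewrite /B; case E: (filter _ _) => [|e l]; first exact: xchooseP.
  have : e \in filter (legal_move b) pairs by rewrite E mem_head.
  by rewrite mem_filter => /andP[].
exists (size pairs); apply/asboolP; exists B => // P; exists (size pairs) => //.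
pose missing t := count (legal_move (play B P t)) pairs.
have mono b e c : subpred (legal_move (rcons b (e, c))) (legal_move b).
  move=> [x y] /andP[/= xy]; rewrite /legal_move /= xy /adjacent /has_edge.
  by rewrite !mem_rcons !inE !negb_or => /andP[/andP[/andP[_ ->] /andP[_ ->]]
    /andP[/andP[_ ->] /andP[_ ->]]].
have dec t : (missing t <= size pairs - t)%N.
  elim: t => [|t IHt]; first by rewrite subn0 count_size.
  have : (missing t.+1 <= (missing t).-1)%N; last by lia.
  rewrite /missing /=; set b := play B P t.
  have [z|nz] := posnP (count (legal_move b) pairs).
    by apply: leq_trans (sub_count (@mono _ _ _) _) _; rewrite -/b z.
  have Bp : B b \in filter (legal_move b) pairs.
    rewrite /B; move: nz; rewrite -size_filter.
    by case: (filter _ _) => // e l _; rewrite mem_head.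
  set b' := rcons _ _.
  have Bl : ~~ legal_move b' (B b).
    rewrite /legal_move /b' /adjacent /has_edge !mem_rcons !inE -surjective_pairing.
    by case: (P b (B b)); rewrite eqxx /= ?orbT ?andbF.
  rewrite -!size_filter -(size_rem Bp).
  have -> : filter (legal_move b') pairs =
            filter (legal_move b') (rem (B b) (filter (legal_move b) pairs)).
    have -> : filter (legal_move b') pairs =
              filter (legal_move b') (filter (legal_move b) pairs).
      rewrite -filter_predI; apply: eq_filter => e /=.
      by case E: (legal_move b' e) => //=; rewrite (mono _ _ _ _ E).
    elim: (filter (legal_move b) pairs) => //= e l IHl.
    case: eqP => [->|_]; first by rewrite (negPf Bl).
    by rewrite /= IHl.
  by rewrite size_filter count_size.
have /(_ (size pairs)) := dec; rewrite subnn leqn0 /missing => /eqP c0.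
set b := play _ _ _ in c0 *.
have adj x y : x \in s -> y \in s -> x != y -> adjacent b x y.
  move=> xs ys xy; have : (x, y) \in pairs by apply/allpairsP; exists (x, y).
  move=> /(hasPn _) h; apply/negPn/negP => nadj.
  have : has (legal_move b) pairs.
    apply/hasP; exists (x, y); last by rewrite /legal_move /= xy.
    by apply/allpairsP; exists (x, y).
  by rewrite has_count c0.
have szs : (N <= size s)%N by rewrite size_iota.
have [[s' [u' z' sub' cl]]|[s' [u' z' sub' cl]]] :=
  HN (has_edge true b) s (has_edgeC true b) (iota_uniq _ _) szs.
- by left; exists s'.
- right; exists s'; split=> // x y xs ys xy.
  by have := adj x y (sub' _ xs) (sub' _ ys) xy; rewrite /adjacent
    (negPf (cl x y xs ys xy)).
Qed.

Definition online_ramsey (m n : nat) : nat := ex_minn (builder_guarantees_ex m n).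

(* Main.v *)
Require Import Defs.
From mathcomp Require Import all_boot all_order all_algebra.
From mathcomp Require Import all_classical all_reals all_analysis.
(* Imported again because classical_sets shadows set0, setU, subsetP, etc. *)
From mathcomp Require Import fintype finset.
From mathcomp Require Import zify ring lra.
Import Order.TTheory GRing.Theory Num.Theory numFieldNormedType.Exports.

Set Implicit Arguments.
Unset Strict Implicit.
Unset Printing Implicit Defensive.
Local Open Scope ring_scope.

(* Let k = m/2 + 1 (rounded down) and let N be of order
   n^(k-1) / (log n)^(k-2), the Ajtai-Komlos-Szemeredi bound for r(k, n).
   Builder plays the Erdos-Szekeres argument vertex by vertex on
   N n^(m-k) vertices, joining the current vertex to all remaining candidates
   and keeping those of one colour.  After O(n) rounds, either Builder has won
   or m - k red steps have been made and N candidates are left, among which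
   Builder places all edges.  The cost is
   O(n) N n^(m-k) + N^2, and 2(k-1) <= m makes the first term dominate.

   The bound on r(k, n) is proved by induction on k.  Red degrees are at most
   D ~ r(k-1, n) and red codegrees at most M ~ n^(k-3); a random set of the
   hard-core model on the red graph, with fugacity of order 1/M, then has
   expected size of order (|V| / D) log(D / M). *)

(** * Cliques and stable sets in finite graphs *)

Section Graphs.
Variables (T : finType) (e : rel T).

Definition clique (K : {set T}) : bool :=
  [forall x in K, forall y in K, (x != y) ==> e x y].

Definition stable (K : {set T}) : bool :=
  [forall x in K, forall y in K, ~~ e x y].

Definition nbhd (v : T) : {set T} := [set u | e v u].

Lemma cliqueP (K : {set T}) : reflect {in K &, forall x y, x != y -> e x y} (clique K).
Proof.
apply: (iffP forall_inP) => [h x y xK yK xy|h x xK].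
  by have /forall_inP/(_ y yK)/implyP/(_ xy) := h x xK.
by apply/forall_inP => y yK; apply/implyP; exact: h.
Qed.

Lemma stableP (K : {set T}) : reflect {in K &, forall x y, ~~ e x y} (stable K).
Proof.
apply: (iffP forall_inP) => [h x y xK yK|h x xK].
  by have /forall_inP/(_ y yK) := h x xK.
by apply/forall_inP => y yK; exact: h.
Qed.

Lemma stable_sub (K L : {set T}) : K \subset L -> stable L -> stable K.
Proof.
move=> /subsetP KL /stableP h; apply/stableP => x y xK yK.
by apply: h; exact: KL.
Qed.

End Graphs.

(** * The hard-core model *)

Section HardCore.
Variables (R : realType) (T : finType) (e : rel T).
Hypotheses (e_sym : symmetric e) (e_irr : irreflexive e).
Variable lam : R.
Hypothesis lam_gt0 : 0 < lam.

Implicit Types (V W I J K : {set T}) (u v : T).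

Local Notation nb := (nbhd e).

Definition indep (V K : {set T}) : bool := (K \subset V) && stable e K.

Definition partition_fun (V : {set T}) : R := \sum_(K | indep V K) lam ^+ #|K|.

(** Unnormalised: dividing by [partition_fun V] gives the probability that the random set contains
    [u]. *)
Definition occupation (V : {set T}) (u : T) : R :=
  \sum_(K | indep V K && (u \in K)) lam ^+ #|K|.

Local Notation Z := partition_fun.
Local Notation occ := occupation.

Let w_ge0 (K : {set T}) : 0 <= lam ^+ #|K|.
Proof. by rewrite exprn_ge0 // ltW. Qed.

Lemma indep0 V : indep V set0.
Proof. by rewrite /indep sub0set; apply/stableP => x y; rewrite inE. Qed.

Lemma partition_fun_mono (V W : {set T}) : W \subset V -> Z W <= Z V.
Proof.
move=> WV; rewrite /Z [leRHS](bigID (fun K => indep W K)) /=.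
rewrite [X in _ <= X + _](_ : _ = Z W); last first.
  apply: eq_bigl => K; rewrite /indep.
  case: (boolP (K \subset W)) => [KW|]; last by rewrite !andbF.
  by rewrite (subset_trans KW WV) /=; case: stable.
by rewrite lerDl sumr_ge0.
Qed.

Lemma partition_fun_ge1 V : 1 <= Z V.
Proof.
rewrite /Z (bigD1 set0) ?indep0 //= cards0 expr0 lerDl sumr_ge0 //.
Qed.

(* Removing u maps the independent sets through u bijectively onto those
   avoiding its closed neighbourhood. *)
Lemma occupationE V u : u \in V -> occ V u = lam * Z (V :\: (u |: nb u)).
Proof.
move=> uV; rewrite /occ /Z mulr_sumr.
rewrite (reindex_onto (fun K => u |: K) (fun K => K :\ u)) /=; last first.
  by move=> K /andP[_ uK]; rewrite setD1K.
apply: congr_big => // [K|K /andP[/andP[/andP[_ _] _] /eqP]]; last first.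
  move=> E; rewrite cardsU1; have -> : u \notin K by rewrite -E !inE eqxx.
  by rewrite exprS.
rewrite setU11 andbT; apply/andP/andP =>
  [[/andP[sV /stableP st] /eqP E]|[sV /stableP st]].
- have uK : u \notin K by rewrite -E !inE eqxx.
  split.
    apply/subsetP => x xK; rewrite !inE negb_or -andbA; apply/and3P; split.
    + by apply: contraNneq uK => <-.
    + by apply: st; rewrite !inE ?eqxx ?xK ?orbT.
    + by apply: (subsetP sV); rewrite !inE xK orbT.
  by apply/stableP => x y xK yK; apply: st; rewrite !inE ?xK ?yK orbT.
- have h x : x \in K -> [/\ x != u, ~~ e u x & x \in V].
    by move=> /(subsetP sV); rewrite !inE negb_or => /andP[/andP[]].
  have uK : u \notin K by apply/negP => /h[]; rewrite eqxx.
  split; last by rewrite setU1K.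
  apply/andP; split.
    by apply/subsetP => x; rewrite !inE => /orP[/eqP->//|/h[]].
  apply/stableP => x y; rewrite !inE => /orP[/eqP->|xK] /orP[/eqP->|yK].
  + by rewrite e_irr.
  + by case: (h _ yK).
  + by rewrite e_sym; case: (h _ xK).
  + exact: st.
Qed.

Lemma occupation_ge0 V u : 0 <= occ V u.
Proof. exact: sumr_ge0. Qed.

Lemma partition_funD1 V u : Z V = Z (V :\ u) + occ V u.
Proof.
rewrite /Z (bigID (fun K : {set T} => u \in K)) /= addrC; congr (_ + _).
apply: eq_bigl => K; rewrite /indep subsetD1.
by case: (u \in K); rewrite ?andbF ?andbT.
Qed.

(** Union bound: an independent set meeting [W] is counted by each of its vertices in [W]. *)
Lemma partition_funD V W : Z V <= Z (V :\: W) + \sum_(u in V :&: W) occ V u.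
Proof.
rewrite {1}/Z (bigID (fun K : {set T} => [disjoint K & W])) /=; apply: lerD.
  rewrite le_eqVlt; apply/orP; left; apply/eqP; apply: eq_bigl => K.
  by rewrite /indep subsetD -andbA [stable _ _ && _]andbC andbA.
rewrite /occ (exchange_big_dep (indep V)) /=; last by move=> u K _ /andP[].
rewrite big_mkcondr; apply: ler_sum => K iK; have /andP[KV _] := iK.
case: ifP => [|_]; last by apply: sumr_ge0.
rewrite -setI_eq0 => /set0Pn[u /setIP[uK uW]].
rewrite (bigD1 u) /= ?iK ?uK ?inE ?uW ?(subsetP KV) //.
by rewrite lerDl sumr_ge0.
Qed.

(** Adding a vertex multiplies the partition function by at most [1 + lam <= expR lam]. *)
Lemma partition_fun_le_exp V : Z V <= expR (lam * #|V|%:R).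
Proof.
have [n] := ubnP #|V|; elim: n V => // n IH V; rewrite ltnS => Vn.
have [->|/set0Pn[u uV]] := eqVneq V set0.
  rewrite cards0 mulr0 expR0 /Z (big_pred1 set0) ?cards0 ?expr0 // => K.
  by rewrite /= /indep subset0; case: eqP => // ->; have /andP[_ ->] := indep0 V.
have cV := cardsD1 u V; rewrite uV in cV.
have ZV : Z V <= (1 + lam) * Z (V :\ u).
  rewrite (partition_funD1 _ u) mulrDl mul1r lerD2l occupationE //.
  rewrite ler_wpM2l ?(ltW lam_gt0) // partition_fun_mono //.
  by rewrite setDS // sub1set setU11.
apply: le_trans ZV _; rewrite cV natrD mulrDr mulr1 expRD.
apply: ler_pM; rewrite ?addr_ge0 ?(ltW lam_gt0) ?expR_ge1Dx //.
  exact: le_trans (partition_fun_ge1 _).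
by apply: IH; move: Vn; rewrite cV.
Qed.

(** Double counting, that is, linearity of expectation. *)
Lemma sum_card_setI V W :
  \sum_(K | indep V K) lam ^+ #|K| * #|K :&: W|%:R = \sum_(u in V :&: W) occ V u.
Proof.
rewrite /occ (exchange_big_dep (indep V)) /=; last by move=> u K _ /andP[].
apply: eq_bigr => K /andP[KV st].
rewrite -(sum1_card (mem (K :&: W))) natr_sum mulr_sumr.
apply: congr_big => // [u|u _]; last by rewrite mulr1.
rewrite !inE /indep KV st /=.
by case: (boolP (u \in K)) => [/(subsetP KV)->|_] //=; rewrite ?andbT ?andbF.
Qed.

Lemma sum_card V :
  \sum_(K | indep V K) lam ^+ #|K| * #|K|%:R = \sum_(u in V) occ V u.
Proof.
rewrite -{2}[V]setIid -sum_card_setI.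
by apply: eq_bigr => K /andP[/setIidPl-> _].
Qed.

(* In a graph of small maximum degree compared with 1 / lam, the neighbours of
   a vertex are all absent with probability at least 1/2. *)
Lemma sum_card_ge V M :
  (forall u, u \in V -> (#|nb u :&: V| <= M)%N) ->
  lam * M.+1%:R <= 2^-1 ->
  lam * #|V|%:R / 2 * Z V <= \sum_(K | indep V K) lam ^+ #|K| * #|K|%:R.
Proof.
move=> deg lamM; rewrite sum_card.
have Z0 : 0 <= Z V by apply: le_trans (partition_fun_ge1 _).
have occ_le u : u \in V -> occ V u <= lam * Z V.
  move=> uV; rewrite occupationE // ler_wpM2l ?(ltW lam_gt0) //.
  by rewrite partition_fun_mono // subsetDl.
have : forall u, u \in V -> lam / 2 * Z V <= occ V u.
  move=> u uV; rewrite occupationE // -mulrA ler_wpM2l ?(ltW lam_gt0) //.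
  have := partition_funD V (u |: nb u).
  (* At most [M.+1] vertices, each contributing at most [lam * Z V]. *)
  have : \sum_(v in V :&: (u |: nb u)) occ V v <= 2^-1 * Z V.
    apply: (@le_trans _ _ (\sum_(v in V :&: (u |: nb u)) lam * Z V)).
      by apply: ler_sum => v; rewrite inE => /andP[/occ_le].
    rewrite sumr_const -[leLHS]mulr_natr mulrAC ler_wpM2r //.
    apply: le_trans lamM; rewrite ler_wpM2l ?(ltW lam_gt0) // ler_nat.
    rewrite setIUr (leq_trans (leq_card_setU _ _).1) // -[M.+1]add1n.
    rewrite leq_add //; last by rewrite setIC deg.
    by rewrite (leq_trans (subset_leq_card (subsetIr _ _))) ?cards1.
  lra.
move=> h; apply: le_trans (ler_sum _ h); rewrite sumr_const -[leRHS]mulr_natr.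
by rewrite le_eqVlt; apply/orP; left; apply/eqP; ring.
Qed.

(* With J the part of an independent set avoiding v outside N(v), the part
   inside N(v) is an arbitrary independent subset of free_nbhd V v J. *)
Definition free_nbhd (V : {set T}) (v : T) (J : {set T}) : {set T} :=
  [set u in V :&: nb v | [disjoint nb u & J]].

Lemma sum_indep_split V v (g : {set T} -> R) :
  \sum_(I | indep (V :\ v) I) g I =
  \sum_(J | indep (V :\: (v |: nb v)) J)
     \sum_(K | indep (free_nbhd V v J) K) g (J :|: K).
Proof.
rewrite pair_big_dep /=.
rewrite (reindex_onto (fun I : {set T} => (I :\: nb v, I :&: nb v))
                      (fun p => p.1 :|: p.2)) /=; last first.
  case=> J K /=; rewrite /indep => /andP[/andP[sJ stJ] /andP[sK stK]].
  have KN : K \subset nb v.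
    by apply/subsetP => x /(subsetP sK); rewrite !inE => /andP[/andP[]].
  have JN x : x \in J -> e v x = false.
    by move=> /(subsetP sJ); rewrite !inE negb_or => /andP[/andP[_ /negPf->]].
  congr pair; apply/setP => x; rewrite !inE.
    case: (boolP (x \in J)) => [/JN->//|_] /=.
    by case: (boolP (x \in K)) => [/(subsetP KN)|_]; rewrite ?inE ?andbF // => ->.
  case: (boolP (x \in J)) => [xJ|_] /=.
    rewrite JN //; apply/esym/negP => /(subsetP KN); by rewrite inE JN.
  by case: (boolP (x \in K)) => // /(subsetP KN); rewrite inE => ->.
apply: congr_big => // [I|I _]; last by rewrite setUC setID.
rewrite [I :\: _ :|: _]setUC setID eqxx andbT /indep.
apply/andP/andP =>
  [[sI /stableP st]|[/andP[sJ /stableP stJ] /andP[sK /stableP stK]]].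
  split; apply/andP; split.
  - apply/subsetP => x; rewrite !inE negb_or => /andP[/negPf-> /(subsetP sI)].
    by rewrite !inE andbT.
  - by apply: stable_sub (subsetDl _ _) _; apply/stableP.
  - apply/subsetP => x; rewrite !inE => /andP[xI ->].
    have := subsetP sI _ xI; rewrite !inE => /andP[_ ->] /=.
    apply/pred0P => y; rewrite /= !inE.
    apply/negP => /and3P[exy _ yI]; by rewrite (negPf (st _ _ xI yI)) in exy.
  - by apply: stable_sub (subsetIl _ _) _; apply/stableP.
(* No edge joins the two parts, since the vertices inside [nb v] are free of neighbours in [J]. *)
have cross x y : x \in I -> y \in I -> e v x -> ~~ e v y -> ~~ e x y.
  move=> xI yI vx vy; have := subsetP sK x; rewrite !inE xI vx => /(_ isT).
  move=> /andP[_ /pred0P/(_ y)]; rewrite /= !inE yI vy /= andbT.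
  by move=> ->.
split.
  apply/subsetP => x xI; case: (boolP (e v x)) => vx.
    have := subsetP sK x; rewrite !inE xI vx => /(_ isT) /andP[/andP[-> _] _].
    by rewrite andbT; apply: contraTneq vx => ->; rewrite e_irr.
  have := subsetP sJ x; rewrite !inE xI vx => /(_ isT).
  by rewrite negb_or => /andP[/andP[-> _] ->].
apply/stableP => x y xI yI.
case: (boolP (e v x)) => vx; case: (boolP (e v y)) => vy.
- by apply: stK; rewrite !inE ?xI ?yI.
- exact: cross.
- by rewrite e_sym; exact: cross.
- by apply: stJ; rewrite !inE ?xI ?yI ?vx ?vy.
Qed.

Lemma card_split V v J K : indep (V :\: (v |: nb v)) J ->
  indep (free_nbhd V v J) K ->
  #|J :|: K| = (#|J| + #|K|)%N /\ (J :|: K) :&: nb v = K.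
Proof.
move=> /andP[sJ _] /andP[sK _].
have KN : K \subset nb v.
  by apply/subsetP => x /(subsetP sK); rewrite !inE => /andP[/andP[]].
have JN : J :&: nb v = set0.
  apply/setP => x; rewrite !inE; apply/negP => /andP[/(subsetP sJ)].
  by rewrite !inE negb_or => /andP[/andP[_ /negPf->]].
split; last by rewrite setIUl JN set0U (setIidPl KN).
rewrite cardsU; suff -> : J :&: K = set0 by rewrite cards0 subn0.
by apply/eqP; rewrite -subset0 -JN setIS.
Qed.

(** Condition on the part [J] of the random set outside the closed neighbourhood of [v]. The rest is
    either [v] alone, of weight [lam], or an independent set of free neighbours, whose graph is
    sparse by the codegree bound. *)
Lemma local_bound (V : {set T}) v (D L : R) (M : nat) : v \in V ->
  (forall u, u \in V -> e v u -> (#|nb v :&: nb u :&: V| <= M)%N) ->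
  lam * M.+1%:R <= 2^-1 -> 0 <= L -> expR (6 * L) <= D * lam ->
  L * Z V <= D * occ V v + \sum_(u in V :&: nb v) occ V u.
Proof.
move=> vV codeg lamM L0 DL.
have lam1 : lam <= 1.
  apply: le_trans (_ : lam * M.+1%:R <= 1); last by apply: le_trans lamM _; lra.
  by rewrite ler_peMr ?(ltW lam_gt0) // ler1n.
rewrite -sum_card_setI (partition_funD1 _ v) occupationE //.
pose A := \sum_(I | indep (V :\ v) I) lam ^+ #|I| * #|I :&: nb v|%:R.
apply: (@le_trans _ _ (D * (lam * Z (V :\: (v |: nb v))) + A)); last first.
  rewrite lerD2l /A [leRHS](bigID (fun I : {set T} => v \in I)) /=.
  rewrite [X in _ <= _ + X](_ : _ = A); last first.
    apply: eq_bigl => K; rewrite /indep subsetD1.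
    by case: (v \in K); rewrite ?andbF ?andbT.
  by rewrite lerDr sumr_ge0 // => I _; rewrite mulr_ge0.
rewrite /A [Z (V :\ v)]sum_indep_split sum_indep_split.
rewrite [Z _ in X in X <= _]/Z [Z _]/Z !mulr_sumr -!big_split /= mulr_sumr.
apply: ler_sum => J iJ.
rewrite (eq_bigr (fun K => lam ^+ #|J| * lam ^+ #|K|)); last first.
  by move=> K iK; have [-> _] := card_split iJ iK; rewrite exprD.
rewrite [X in _ <= _ + X](eq_bigr
  (fun K => lam ^+ #|J| * (lam ^+ #|K| * #|K|%:R))); last first.
  by move=> K iK; have [-> ->] := card_split iJ iK; rewrite exprD mulrA.
rewrite -!mulr_sumr -/(Z (free_nbhd V v J)).
set H := free_nbhd V v J.
have degH u : u \in H -> (#|nb u :&: H| <= M)%N.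
  rewrite inE => /andP[/setIP[uV]]; rewrite inE => vu _.
  apply: leq_trans (codeg u uV vu); apply: subset_leq_card.
  by apply/subsetP => x; rewrite !inE => /and3P[-> /andP[-> ->] _].
have ZB := sum_card_ge degH lamM.
have Z1 := partition_fun_ge1 H; have ZE := partition_fun_le_exp H.
set B := \sum_(K | _) _ in ZB *; set ZH := Z H in ZB Z1 ZE *.
set h := lam * #|H|%:R in ZB ZE.
(* The inequality for one [J], with the common factor [lam ^+ #|J|] removed. *)
suff : L * (ZH + lam) <= D * lam + B.
  have w0 := w_ge0 J; move=> /(ler_wpM2l w0); nra.
(* Either H is large and its occupied vertices suffice, or Z H <= e^(4 L) and
   the weight D of v itself does. *)
have [h4|h4] := lerP (4 * L) h.
  apply: le_trans (_ : B <= _); last first.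
    by rewrite lerDr; apply: le_trans DL; exact: expR_ge0.
  apply: le_trans ZB; nra.
have ZL : ZH <= expR (4 * L).
  by apply: le_trans ZE _; rewrite ler_expR ltW.
have E2 : 2 * L <= expR (2 * L).
  by apply: le_trans (expR_ge1Dx _); lra.
(* The exponent 6 arises here: [L * (ZH + lam)] is at most [2 * L * expR (4 * L)], and
   [2 * L <= expR (2 * L)]. *)
have E6 : expR (6 * L) = expR (2 * L) * expR (4 * L).
  by rewrite -expRD; congr expR; ring.
have B0 : 0 <= B by apply: sumr_ge0 => K _; rewrite mulr_ge0.
have E40 := expR_ge0 (4 * L).
nra.
Qed.

(* By local_bound summed over V, the expected size of a random independent set
   is at least |V| L / (2 D). *)
Lemma large_stable_set (V : {set T}) (D L : R) (M : nat) :
  (forall u, u \in V -> #|nb u :&: V|%:R <= D) ->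
  (forall u v, u \in V -> v \in V -> e u v -> (#|nb u :&: nb v :&: V| <= M)%N) ->
  lam * M.+1%:R <= 2^-1 -> 0 <= L -> expR (6 * L) <= D * lam ->
  exists2 I, indep V I & #|V|%:R * L <= 2 * D * #|I|%:R.
Proof.
move=> deg codeg lamM L0 DL; apply: contrapT => noI.
have small I : indep V I -> 2 * D * #|I|%:R < #|V|%:R * L.
  by move=> iI; rewrite ltNge; apply/negP => h; apply: noI; exists I.
(* Each [u] is counted once for every neighbour in [V], so at most [D] times. *)
have upper : \sum_(v in V) \sum_(u in V :&: nb v) occ V u <=
             D * \sum_(u in V) occ V u.
  rewrite (exchange_big_dep (mem V)) /=; last by move=> v u _ /setIP[].
  rewrite mulr_sumr; apply: ler_sum => u uV.
  rewrite (eq_bigl (mem (nb u :&: V))) => [|v]; last first.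
    by rewrite /= !inE uV e_sym andbC.
  by rewrite sumr_const -mulr_natl ler_wpM2r ?occupation_ge0 ?deg.
have : #|V|%:R * L * Z V <= 2 * D * \sum_(u in V) occ V u.
  have : \sum_(v in V) L * Z V <=
         \sum_(v in V) (D * occ V v + \sum_(u in V :&: nb v) occ V u).
    apply: ler_sum => v vV; apply: (@local_bound _ _ _ _ M) => // u uV evu.
    exact: codeg.
  rewrite sumr_const -[leLHS]mulr_natl big_split /= -mulr_sumr; lra.
rewrite -sum_card mulr_sumr /Z mulr_sumr; apply/negP; rewrite -ltNge.
(* If every independent set were small, the weighted average would be too; the comparison is
   termwise and strict. *)
apply: ltr_sum; last first.
  by move=> I /small h; rewrite mulrCA mulrC ltr_pM2r ?exprn_gt0.
by apply/hasP; exists set0; rewrite ?mem_index_enum ?indep0.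
Qed.

End HardCore.

(** * Ramsey numbers *)

(** Stated for vertex subsets, so that inductions can pass to neighbourhoods within one graph. *)
Definition ramsey_bound (k n N : nat) : Prop :=
  forall (T : finType) (e : rel T) (V : {set T}),
    symmetric e -> irreflexive e -> (N <= #|V|)%N ->
    (exists K : {set T}, [/\ K \subset V, clique e K & #|K| = k]) \/
    (exists I : {set T}, [/\ I \subset V, stable e I & #|I| = n]).

Lemma cliqueU1 (T : finType) (e : rel T) (v : T) (K : {set T}) :
  symmetric e -> K \subset nbhd e v -> clique e K -> clique e (v |: K).
Proof.
move=> sym /subsetP sK /cliqueP cK; apply/cliqueP => x y.
have h z : z \in K -> e v z by move=> /sK; rewrite inE.
rewrite !inE => /orP[/eqP->|xK] /orP[/eqP->|yK]; first by rewrite eqxx.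
- by move=> _; exact: h.
- by move=> _; rewrite sym; exact: h.
- exact: cK.
Qed.

(** A [k]-clique in the neighbourhood of [v] extends by [v]; this is what limits degrees and
    codegrees below. *)
Lemma ramsey_bound_nbhd (k n N : nat) (T : finType) (e : rel T) (v : T)
    (W V : {set T}) :
  ramsey_bound k n N -> symmetric e -> irreflexive e ->
  v \in V -> W \subset V -> W \subset nbhd e v -> (N <= #|W|)%N ->
  (exists K : {set T}, [/\ K \subset v |: W, clique e K & #|K| = k.+1]) \/
  (exists I : {set T}, [/\ I \subset V, stable e I & #|I| = n]).
Proof.
move=> H sym irr vV WV Wv NW;
have [[K [KW cK <-]]|[I [IW sI <-]]] := H T e W sym irr NW.
  left; exists (v |: K); split; first exact: setUS.
    exact: cliqueU1 sym (subset_trans KW Wv) cK.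
  rewrite cardsU1; suff -> : v \notin K by [].
  by apply/negP => /(subsetP KW)/(subsetP Wv); rewrite inE irr.
by right; exists I; split; rewrite ?(subset_trans IW).
Qed.

(** Yields [n.+1 ^ k.+1 - n.+1 ^ k >= n ^ k.+1], the arithmetic of an Erdos-Szekeres step. *)
Lemma expnS_le_mul (n k : nat) : (n ^ k.+1 <= n * n.+1 ^ k)%N.
Proof. by rewrite expnS leq_mul //; case: k => // k; rewrite leq_exp2r. Qed.

(** Pick a vertex: with many neighbours, recurse among them on a smaller clique; otherwise recurse
    among its non-neighbours on a smaller stable set. *)
Lemma erdos_szekeres (k n : nat) : ramsey_bound k.+1 n (n ^ k).
Proof.
have [s] := ubnP (k + n); elim: s k n => // s IH [|k] [|n] lt T e V sym irr NV.
1,3: by right; exists set0; split; rewrite ?sub0set ?cards0 //; apply/stableP => x y; rewrite inE.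
  have /card_gt0P[v vV] : (0 < #|V|)%N by exact: leq_trans NV.
  left; exists [set v]; split; rewrite ?sub1set ?cards1 //.
  by apply/cliqueP => x y /set1P-> /set1P->; rewrite eqxx.
have /card_gt0P[v vV] : (0 < #|V|)%N by apply: leq_trans NV; rewrite expn_gt0.
have [big|small] := leqP (n.+1 ^ k) #|V :&: nbhd e v|.
  have IHk := IH k n.+1 ltac:(lia).
  have [[K [KW cK szK]]|] :=
    ramsey_bound_nbhd IHk sym irr vV (subsetIl _ _) (subsetIr _ _) big;
    last by right.
  left; exists K; split=> //; apply: subset_trans KW _.
  by rewrite subUset sub1set vV subsetIl.
have cV := cardsID (nbhd e v) V.
have cN := cardsD1 v (V :\: nbhd e v).
have vN : v \in V :\: nbhd e v by rewrite !inE irr vV.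
rewrite vN in cN.
(* The strict inequality [small] pays for the removal of [v]. *)
have sz : (n ^ k.+1 <= #|(V :\: nbhd e v) :\ v|)%N.
  have := expnS_le_mul n k.
  rewrite expnS mulSn in NV; lia.
have [[K [KW cK <-]]|[I [IW sI szI]]] := IH k.+1 n ltac:(lia) T e _ sym irr sz.
  by left; exists K; split; rewrite ?(subset_trans KW) // setDDl subsetDl.
right; exists (v |: I); split.
- by rewrite subUset sub1set vV (subset_trans IW) // setDDl subsetDl.
- have h z : z \in I -> ~~ e v z by move=> /(subsetP IW); rewrite !inE => /and3P[].
  move/stableP: sI => sI; apply/stableP => x y.
  rewrite !inE => /orP[/eqP->|xK] /orP[/eqP->|yK]; first by rewrite irr.
  + exact: h.
  + by rewrite sym; exact: h.
  + exact: sI.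
- rewrite cardsU1 szI; suff -> : v \notin I by [].
  by apply/negP => /(subsetP IW); rewrite !inE eqxx.
Qed.

Lemma ln_ge_near (R : realType) (Y : R) :
  exists n0 : nat, forall n : nat, (n0 <= n)%N -> Y <= ln (n%:R : R).
Proof.
exists (Num.truncn (expR Y)).+1 => n hn.
have h : expR Y <= n%:R.
  by apply: le_trans (ltW (truncnS_gt _)) _; rewrite ler_nat.
by rewrite -[Y]expRK ler_ln // posrE ?(lt_le_trans _ h) ?expR_gt0.
Qed.

(** With [a = 2 * k.+1], [expR (y / 2)] is the power [k.+1] of [expR (y / a)], hence at least
    [(y / a) ^+ k.+1]; the spare factor [y] absorbs the constants. *)
Lemma pow_le_expR (R : realType) (k : nat) (c : R) : 0 < c ->
  exists Y : R, forall y, Y <= y -> y ^+ k <= c * expR (y / 2).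
Proof.
move=> c0; set a : R := 2 * k.+1%:R.
have a0 : 0 < a by rewrite mulr_gt0.
exists (Num.max 0 (a ^+ k.+1 / c)) => y; rewrite ge_max => /andP[y0 hy].
have E : (y / a) ^+ k.+1 <= expR (y / 2).
  have -> : y / 2 = k.+1%:R * (y / a) by rewrite /a; field; rewrite nat1r pnatr_eq0.
  rewrite expRM_natl lerXn2r ?nnegrE ?expR_ge0 ?divr_ge0 ?(ltW a0) //.
  by apply: le_trans (expR_ge1Dx _); rewrite lerDr.
have : y ^+ k * (a ^+ k.+1 / c) <= y ^+ k * y.
  by rewrite ler_wpM2l // exprn_ge0.
rewrite expr_div_n ler_pdivrMr ?exprn_gt0 // in E.
rewrite -exprSr mulrA ler_pdivrMr // => h.
have := le_trans h (ler_wpM2r (ltW c0) E).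
by rewrite mulrAC [expR _ * c]mulrC ler_pM2r // exprn_gt0.
Qed.

Lemma ajtai_komlos_szemeredi (R : realType) (k : nat) :
  exists C : R, 0 < C /\ exists n0 : nat, forall n N : nat, (n0 <= n)%N ->
    C * n%:R ^+ k.+1 / ln n%:R ^+ k <= N%:R -> ramsey_bound k.+2 n N.
Proof.
elim: k => [|k [C [C0 [n1 IH]]]].
  exists 1; split=> //; exists 0%N => n N _.
  rewrite expr0 divr1 mul1r expr1 ler_nat => nN.
  have := @erdos_szekeres 1 n; rewrite expn1 => H T e V sym irr NV.
  by apply: H => //; exact: leq_trans NV.
(* 24 is 2 from [large_stable_set] times 12 from the choice [L = l / 12]. *)
exists (24 * C); split; first by rewrite mulr_gt0.
have [Y HY] := pow_le_expR k (divr_gt0 C0 (ltr0n R 2)).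
have [n2 Hn2] := ln_ge_near (Num.max 1 Y).
exists (maxn n1 (maxn n2 1)) => n N; rewrite !geq_max => /and3P[hn1 /Hn2 + n_gt0].
move=> + hN T e V sym irr NV.
rewrite ge_max => /andP[ln1 lnY].
set x : R := n%:R in ln1 lnY hN *; set l := ln x in ln1 lnY hN *.
have x0 : 0 < x by rewrite ltr0n.
have l0 : 0 < l by apply: lt_le_trans ln1.
pose D : R := C * x ^+ k.+1 / l ^+ k.
have D0 : 0 < D by rewrite divr_gt0 ?mulr_gt0 ?exprn_gt0.
have [[v [vV vD]]|degs] :=
  pselect (exists v, v \in V /\ D <= #|nbhd e v :&: V|%:R).
  have [[K [KW cK szK]]|] := ramsey_bound_nbhd (IH n _ hn1 vD) sym irr vV
    (subsetIr _ _) (subsetIl _ _) (leqnn _); last by right.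
  left; exists K; split=> //; apply: subset_trans KW _.
  by rewrite subUset sub1set vV subsetIr.
(* A [k.+1]-clique among the common neighbours of an edge extends by both of its ends. *)
have [[u [v [uV vV euv codeg]]]|codegs] := pselect (exists u v,
    [/\ u \in V, v \in V, e u v & (n ^ k <= #|nbhd e u :&: nbhd e v :&: V|)%N]).
  have [[K [KW cK szK]]|] := ramsey_bound_nbhd (@erdos_szekeres k n) sym irr vV
    (subsetIr _ _) (subset_trans (subsetIl _ _) (subsetIr _ _)) codeg;
    last by right.
  have KV : K \subset V.
    by apply: subset_trans KW _; rewrite subUset sub1set vV subsetIr.
  left; exists (u |: K); split.
  - by rewrite subUset sub1set uV.
  - apply: cliqueU1 => //; apply: subset_trans KW _.
    by rewrite subUset sub1set inE euv -setIA subsetIl.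
  - rewrite cardsU1 szK; suff -> : u \notin K by [].
    apply/negP => /(subsetP KW); rewrite !inE irr /= orbF => /eqP E.
    by rewrite E irr in euv.
have nk0 : (0 < n ^ k)%N by rewrite expn_gt0 n_gt0.
(* Codegrees are now below [n ^ k], so [M = (n ^ k).-1] makes [lam * M.+1] exactly 1/2. *)
pose lam : R := (2 * x ^+ k)^-1.
have lam0 : 0 < lam by rewrite invr_gt0 mulr_gt0 ?exprn_gt0.
have l12 : 0 <= l / 12 by lra.
have lamM : lam * (n ^ k).-1.+1%:R <= 2^-1.
  by rewrite prednK // natrX -/x /lam invfM mulfVK // gt_eqF ?exprn_gt0.
(* The left side is the square root of [x], while [D * lam] is [x] up to a constant and a power of
   [l]. *)
have DL : expR (6 * (l / 12)) <= D * lam.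
  have -> : 6 * (l / 12) = l / 2 by field.
  have := HY l lnY.
  have -> : D * lam = C / 2 * x / l ^+ k.
    rewrite /D /lam exprS; field.
    by rewrite !expf_neq0 ?gt_eqF.
  rewrite ler_pdivlMr ?exprn_gt0 // => h.
  rewrite -[X in _ <= _ * X](lnK (x0 : x \is Num.pos)) -/l.
  have -> : expR l = expR (l / 2) * expR (l / 2) by rewrite -expRD; congr expR; field.
  by rewrite mulrA mulrC ler_pM2r ?expR_gt0.
have [||I /andP[IV sI] hI] := large_stable_set sym irr lam0 _ _ lamM l12 DL (V := V).
- move=> v vV; rewrite leNgt; apply/negP => h; apply: degs; exists v.
  by split=> //; exact: ltW.
- move=> u v uV vV euv; rewrite -ltnS prednK // ltnNge; apply/negP => h.
  by apply: codegs; exists u, v.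
have nI : (n <= #|I|)%N.
  have D20 : 0 < 2 * D by rewrite pmulr_rgt0.
  rewrite -(ler_nat R) -/x -(ler_pM2l D20).
  apply: le_trans hI.
  apply: (@le_trans _ _ (N%:R * (l / 12))); last by rewrite ler_wpM2r // ler_nat.
  apply: le_trans (ler_wpM2r l12 hN).
  rewrite le_eqVlt; apply/orP; left; apply/eqP.
  rewrite /D !exprS; field.
  by rewrite ?expf_neq0 ?gt_eqF.
right.
have /card_geqP[s [us szs sI']] := nI.
have JI : [set x in s] \subset I by apply/subsetP => y; rewrite inE => /sI'.
exists [set x in s]; split; first exact: subset_trans IV.
  exact: stable_sub sI.
by rewrite cardsE (card_uniqP us).
Qed.

(** * Builder's strategy *)

Section Strategies.
Local Open Scope nat_scope.
Implicit Types (b : board) (Q : board -> Prop) (s S : seq nat).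

(** Game-tree form of a Builder strategy: both colours are allowed at every move, so strategies
    compose without naming a [builder] or a [painter]. *)
Fixpoint force Q (t : nat) b : Prop :=
  Q b \/
  if t is t'.+1 then
    exists2 e, legal_move b e & forall c, force Q t' (rcons b (e, c))
  else False.

Lemma force_now Q t b : Q b -> force Q t b.
Proof. by case: t; left. Qed.

Lemma force_leq Q t t' b : t <= t' -> force Q t b -> force Q t' b.
Proof.
elim: t t' b => [|t IH] [|t'] b //= tt'; first by case=> // ?; left.
case=> [?|[e le H]]; [by left|right]; exists e => // c.
by apply: IH.
Qed.

(** Running one strategy after another adds the costs, and edges already placed persist. *)
Lemma force_bind Q Q' t t' b :
  force Q t b -> (forall b', {subset b <= b'} -> Q b' -> force Q' t' b') ->
  force Q' (t + t') b.
Proof.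
elim: t b => [|t IH] b /=; first by case=> // Qb; apply.
case=> [Qb|[e le H]] H'.
  by apply: (force_leq (leq_addl t.+1 t')); exact: H'.
right; exists e => // c; apply: IH => // b' sb; apply: H' => x xb.
by apply: sb; rewrite mem_rcons inE xb orbT.
Qed.

(** The size of the board tells how many turns remain, so Builder can choose a move that still
    forces a win in that time. Boards without such a move get an arbitrary legal one. *)
Lemma force_guarantees m n t :
  force (builder_won m n) t [::] -> builder_guarantees m n t.
Proof.
move=> F0; pose good b e := legal_move b e /\
  forall c, force (builder_won m n) (t - (size b).+1) (rcons b (e, c)).
pose B b : edge := if pselect (exists e, good b e) is left h then projT1 (cid h)
                   else xchoose (legal_move_ex b).
exists B => [b|P].
  rewrite /B; case: pselect => [h|_]; last exact: xchooseP.
  by case: (cid h) => e /= [].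
have sz i : size (play B P i) = i by elim: i => //= i IH; rewrite size_rcons IH.
have inv i : i <= t -> (exists2 t', t' <= t & builder_won m n (play B P t')) \/
                       force (builder_won m n) (t - i) (play B P i).
  elim: i => [|i IH] it; first by right; rewrite subn0.
  have [|h] := IH (ltnW it); first by left.
  rewrite -(subnSK it) /= in h; case: h => [won|[e le H]].
    by left; exists i => //; exact: ltnW.
  right; have gd : good (play B P i) (B (play B P i)).
    rewrite /B; case: pselect => [h|[]]; first by case: (cid h).
    by exists e; split=> //; rewrite sz.
  by have [_ /(_ (P (play B P i) (B (play B P i))))] := gd; rewrite sz.
have [//|] := inv t (leqnn t); rewrite subnn => -[won|//].
by exists t.
Qed.

Lemma has_edge_sub c b b' x y :
  {subset b <= b'} -> has_edge c b x y -> has_edge c b' x y.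
Proof. by move=> sb /orP[] /sb h; apply/orP; [left|right]. Qed.

Lemma adjacent_mono b b' x y :
  {subset b <= b'} -> Defs.adjacent b x y -> Defs.adjacent b' x y.
Proof. by move=> sb /orP[] /(has_edge_sub sb) h; apply/orP; [left|right]. Qed.

(** Edges already on the board are skipped, which only lowers the cost. *)
Lemma force_edges b (L : seq edge) :
  {in L, forall e, e.1 != e.2} ->
  force (fun b' => {in L, forall e, Defs.adjacent b' e.1 e.2}) (size L) b.
Proof.
elim: L b => [|e L IH] b Lok; first by left.
have Lok' : {in L, forall e, e.1 != e.2}.
  by move=> x xL; apply: Lok; rewrite inE xL orbT.
have fin b1 : Defs.adjacent b1 e.1 e.2 ->
    force (fun b' => {in e :: L, forall e, Defs.adjacent b' e.1 e.2}) (size L) b1.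
  move=> adj; rewrite -[size L]addn0; apply: force_bind (IH b1 Lok') _ => b2 sb h.
  left=> x; rewrite inE => /orP[/eqP->|]; last exact: h.
  exact: adjacent_mono adj.
have [adj|nadj] := boolP (Defs.adjacent b e.1 e.2).
  by apply: (force_leq (leqnSn _)); exact: fin.
right; exists e; first by rewrite /legal_move nadj Lok ?mem_head.
move=> c; apply: fin; rewrite /Defs.adjacent /has_edge !mem_rcons !inE.
by rewrite -surjective_pairing; case: c; rewrite eqxx ?orbT.
Qed.

(** Confined to [S], so that a vertex joined to all of [S] in colour [c] extends the clique. *)
Definition mono_clique (c : bool) (k : nat) S b : Prop :=
  exists s, [/\ uniq s, size s = k, {subset s <= S} &
    {in s &, forall x y, x != y -> has_edge c b x y}].

Lemma mono_clique_leq c k k' S S' b : k' <= k -> {subset S <= S'} ->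
  mono_clique c k S b -> mono_clique c k' S' b.
Proof.
move=> kk sS [s [us sz sub cl]]; exists (take k' s); split.
- exact: take_uniq.
- by rewrite size_takel // sz.
- by move=> x /mem_take/sub/sS.
- by move=> x y /mem_take xs /mem_take ys; exact: cl.
Qed.

Lemma mono_clique_cons c k S b v : v \notin S ->
  {in S, forall x, has_edge c b v x} -> mono_clique c k S b ->
  mono_clique c k.+1 (v :: S) b.
Proof.
move=> vS vE [s [us sz sub cl]]; exists (v :: s); split.
- by rewrite /= us andbT; apply: contra vS => /sub.
- by rewrite /= sz.
- by move=> x; rewrite !inE => /orP[->//|/sub->]; rewrite orbT.
- move=> x y; rewrite !inE => /orP[/eqP->|xs] /orP[/eqP->|ys].
  + by rewrite eqxx.
  + by move=> _; apply: vE; exact: sub.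
  + by move=> _; rewrite has_edgeC; apply: vE; exact: sub.
  + exact: cl.
Qed.

(** Apply the Ramsey bound to the red graph on [S]: all pairs are adjacent, so its stable sets are
    blue cliques. *)
Lemma ramsey_complete_board k n N S b : ramsey_bound k n N -> N <= size S ->
  uniq S -> {in S &, forall x y, x != y -> Defs.adjacent b x y} ->
  mono_clique true k S b \/ mono_clique false n S b.
Proof.
move=> H NS uS adj.
pose e (x y : seq_sub S) := (x != y) && has_edge true b (val x) (val y).
have sym : symmetric e by move=> x y; rewrite /e eq_sym has_edgeC.
have irr : irreflexive e by move=> x; rewrite /e eqxx.
have cS : N <= #|[set: seq_sub S]| by rewrite cardsT card_seq_sub.
have lift c (K : {set seq_sub S}) :
    {in K &, forall x y, x != y -> has_edge c b (val x) (val y)} ->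
    mono_clique c #|K| S b.
  move=> cK; exists [seq val x | x <- enum K]; split.
  - by rewrite map_inj_uniq ?enum_uniq //; exact: val_inj.
  - by rewrite size_map -cardE.
  - by move=> _ /mapP[x _ ->]; exact: valP.
  - move=> _ _ /mapP[x + ->] /mapP[y + ->]; rewrite !mem_enum => xK yK xy.
    by apply: cK => //; apply: contraNneq xy => ->.
have [[K [_ /cliqueP cK <-]]|[I [_ /stableP sI <-]]] := H _ e _ sym irr cS.
- by left; apply: lift => x y xK yK xy; have /andP[] := cK x y xK yK xy.
- right; apply: lift => x y xI yI xy; have := sI x y xI yI; rewrite /e xy /=.
  have := adj (val x) (val y) (valP x) (valP y).
  by rewrite (inj_eq val_inj) => /(_ xy) /orP[->|].
Qed.

(** [p] and [i] count the red and blue steps left. Each round joins one vertex to the other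
    candidates, at most [F] edges, and there are at most [p + i] rounds; the last phase fills in [N]
    candidates. *)
Lemma force_mono_clique k n N F p i S b :
  ramsey_bound k n N -> 0 < N -> i <= n -> uniq S ->
  N * i ^ p <= size S <= F ->
  force (fun b' => mono_clique true (k + p) S b' \/ mono_clique false i S b')
        ((p + i) * F + N * N) b.
Proof.
move=> H N0; elim: p i S b => [|p IHp] i S b.
  rewrite expn0 muln1 addn0 => iN uS /andP[NS _].
  apply: (force_leq (leq_addl _ _)); set S' := take N S.
  have szS : size S' = N by rewrite size_takel.
  pose L := [seq (x, y) | x <- S', y <- S'].
  pose L' := [seq e <- L | e.1 != e.2].
  have Lok : {in L', forall e, e.1 != e.2}.
    by move=> e; rewrite mem_filter => /andP[].
  have szL : size L' + 0 <= N * N.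
    rewrite addn0 size_filter (leq_trans (count_size _ _)) //.
    by rewrite size_allpairs szS.
  apply: (force_leq szL); apply: force_bind (force_edges b Lok) _ => b' _ adj.
  left; have S'S : {subset S' <= S} by move=> x /mem_take.
  have [|||h|h] := @ramsey_complete_board k n N S' b' H.
  - by rewrite szS.
  - exact: take_uniq.
  - move=> x y xS yS xy; apply: (adj (x, y)); rewrite mem_filter xy /=.
    by apply/allpairsP; exists (x, y).
  - by left; apply: mono_clique_leq h.
  - by right; apply: mono_clique_leq h.
elim: i S b => [|i IHi] S b iN uS /andP[NS SF].
  by apply: force_now; right; exists [::].
case: S uS NS SF => [|v S] uS NS SF.
  by move: NS; rewrite leqn0 muln_eq0 expn_eq0 /= orbF -leqn0 leqNgt N0.
have /= /andP[vS uS'] := uS.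
have Lok : {in [seq (v, x) | x <- S], forall e : edge, e.1 != e.2}.
  by move=> _ /mapP[x xS ->] /=; apply: contraNneq vS => ->.
have := force_edges b Lok; rewrite size_map => HL.
have cost : size S + ((p + i.+1) * F + N * N) <= (p.+1 + i.+1) * F + N * N.
  by rewrite addSn mulSn -addnA leq_add2r ltnW.
apply: (force_leq cost); apply: force_bind HL _ => b1 _ adj.
have vred x : x \in S -> ~~ has_edge true b1 v x -> has_edge false b1 v x.
  move=> xS /negPf nr; have /(_ _) := adj (v, x); rewrite /Defs.adjacent nr /=.
  by apply; apply/mapP; exists x.
pose W c := [seq x <- S | has_edge true b1 v x == c].
have WS c : {subset W c <= S} by move=> x; rewrite mem_filter => /andP[].
have uW c : uniq (W c) by exact: filter_uniq.
have vW c : v \notin W c by apply: contra vS; exact: WS.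
have vWS c : {subset v :: W c <= v :: S}.
  by move=> x; rewrite !inE => /orP[->//|/WS->]; rewrite orbT.
have WF c : size (W c) <= F.
  by rewrite size_filter (leq_trans (count_size _ _)) // ltnW.
have Wsize : size (W true) + size (W false) = size S.
  rewrite !size_filter -(count_predC (fun x => has_edge true b1 v x == true) S).
  by congr addn; apply: eq_count => x /=; case: has_edge.
have Wtrue b2 x : {subset b1 <= b2} -> x \in W true -> has_edge true b2 v x.
  by move=> sb; rewrite mem_filter => /andP[/eqP h _]; exact: has_edge_sub h.
have Wfalse b2 x : {subset b1 <= b2} -> x \in W false -> has_edge false b2 v x.
  move=> sb; rewrite mem_filter => /andP[/eqP h xS]; apply: has_edge_sub sb _.
  by apply: vred => //; rewrite h.
rewrite -[_ + N * N]addn0.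
(* With enough red neighbours a red step is made, otherwise a blue one. *)
have [big|small] := leqP (N * i.+1 ^ p) (size (W true)).
  have F1 : N * i.+1 ^ p <= size (W true) <= F by rewrite big WF.
  apply: force_bind (IHp i.+1 (W true) b1 iN (uW _) F1) _ => b2 sb [h|h].
    left; left; rewrite addnS; apply: mono_clique_leq (leqnn _) (vWS true) _.
    by apply: mono_clique_cons => // x; exact: Wtrue.
  left; right; apply: mono_clique_leq (leqnn _) _ h.
  by move=> x /WS xS; rewrite inE xS orbT.
(* As in [erdos_szekeres], strictness of [small] pays for [v]. *)
have F1 : N * i ^ p.+1 <= size (W false) <= F.
  rewrite WF andbT.
  have := expnS_le_mul i p; rewrite -(leq_pmul2l N0) => le1.
  move: NS; rewrite /= expnS mulSn mulnDr; lia.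
rewrite -[p + i.+1]addSnnS.
apply: force_bind (IHi (W false) b1 (ltnW iN) (uW _) F1) _ => b2 sb [h|h].
  left; left; apply: mono_clique_leq (leqnn _) _ h.
  by move=> x /WS xS; rewrite inE xS orbT.
left; right; apply: mono_clique_leq (leqnn _) (vWS false) _.
by apply: mono_clique_cons => // x; exact: Wfalse.
Qed.

Lemma online_ramsey_le k n N p : ramsey_bound k n N -> 0 < N ->
  online_ramsey (k + p) n <= (p + n) * (N * n ^ p) + N * N.
Proof.
move=> H N0; rewrite /online_ramsey; case: ex_minnP => t _; apply; apply/asboolP.
apply: force_guarantees; rewrite -[_ + N * N]addn0.
have sz : N * n ^ p <= size (iota 0 (N * n ^ p)) <= N * n ^ p.
  by rewrite size_iota leqnn.
apply: force_bind (force_mono_clique [::] H N0 (leqnn n) (iota_uniq _ _) sz) _.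
by move=> b _ [[s [us ss _ cl]]|[s [us ss _ cl]]]; left; [left|right]; exists s.
Qed.

End Strategies.

(** * The asymptotic bound *)

Local Open Scope classical_set_scope.
Local Open Scope ring_scope.

Theorem theorem5 (R : realType) (m : nat) (hm : (3 <= m)%N) :
  (fun n : nat => (online_ramsey m n)%:R : R) =O_\oo
  (fun n : nat => n%:R ^+ m / ln (n%:R : R) ^+ (m./2 - 1)).
Proof.
set j := (m./2 - 1)%N.
have [p mE] : exists p, m = (j.+2 + p)%N by exists (m - j.+2)%N; lia.
(* Makes the final phase affordable: [N * N] has order at most [x ^+ m] over a power of [l]. *)
have jm : (2 * j.+1 <= m)%N by rewrite /j; lia.
have [C [C0 [n1 HC]]] := ajtai_komlos_szemeredi R j.
have [n2 Hn2] := @ln_ge_near R 1.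
(* The first summand pays for the rounds, the second for the final [N * N] edges. *)
apply/eqO_exP; exists (m.+1%:R * (C + 1) + (C + 1) ^+ 2).
  by rewrite ltr_wpDr ?exprn_ge0 ?mulr_gt0 ?addr_gt0 ?addr_ge0 // ltW.
exists (maxn n1 (maxn n2 1)) => // n /=.
rewrite !geq_max => /and3P[hn1 /Hn2 ln1 n0].
set x : R := n%:R in ln1 *; set l := ln x in ln1 *.
have x1 : 1 <= x by rewrite ler1n.
have x0 : 0 < x by apply: lt_le_trans x1.
have l0 : 0 < l by apply: lt_le_trans ln1.
have lx : l <= x.
  have := @le_ln1Dx R (x - 1); rewrite addrCA subrr addr0 -/l; lra.
pose q : R := x ^+ j.+1 / l ^+ j.
(* Lets the rounding of [C * q] up to [N] be absorbed into [(C + 1) * q]. *)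
have q1 : 1 <= q.
  rewrite ler_pdivlMr ?exprn_gt0 // mul1r exprS.
  apply: (@le_trans _ _ (x ^+ j)); last by rewrite ler_peMl ?exprn_ge0 // ltW.
  by rewrite lerXn2r // nnegrE ltW.
pose N := (Num.truncn (C * q)).+1.
have NC : C * q <= N%:R by rewrite ltW // truncnS_gt.
have Nq : N%:R <= (C + 1) * q.
  rewrite mulrDl mul1r -natr1 lerD // truncn_le // mulr_ge0 ?(ltW C0) //.
  exact: le_trans q1.
have HN : ramsey_bound j.+2 n N by apply: HC => //; rewrite -mulrA.
have := online_ramsey_le p HN (ltn0Sn _); rewrite -mE.
rewrite -(ler_nat R) natrD !natrM natrX -/x => h.
rewrite ger0_norm //.
have lj0 : 0 < l ^+ j by rewrite exprn_gt0.
have xm0 : 0 < x ^+ m by rewrite exprn_gt0.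
rewrite ger0_norm ?divr_ge0 ?(ltW xm0) ?(ltW lj0) //; apply: le_trans h _.
rewrite mulrDl; apply: lerD.
  have -> : m.+1%:R * (C + 1) * (x ^+ m / l ^+ j) =
            (m.+1%:R * x) * ((C + 1) * q * x ^+ p).
    by rewrite /q mE exprD !exprS; ring.
  apply: ler_pM => //; rewrite ?mulr_ge0 ?exprn_ge0 ?(ltW x0) //.
    rewrite /x -natrM ler_nat mulSn addnC leq_add2l.
    by apply: (@leq_trans m); [lia|rewrite leq_pmulr].
  by rewrite ler_wpM2r ?exprn_ge0 ?(ltW x0).
apply: (@le_trans _ _ (((C + 1) * q) * ((C + 1) * q))); first exact: ler_pM.
have -> : (C + 1) * q * ((C + 1) * q) = (C + 1) ^+ 2 * (q * q) by ring.
rewrite ler_wpM2l ?exprn_ge0 ?addr_ge0 ?(ltW C0) // /q.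
(* Here [2 * j.+1 <= m] bounds the power of [x], and [1 <= l] allows replacing [l ^+ (2 * j)] by
   [l ^+ j]. *)
rewrite mulrACA -exprD addnn -mul2n -invfM; apply: ler_pM.
- by rewrite exprn_ge0 // ltW.
- by rewrite invr_ge0 mulr_ge0 // ltW.
- exact: ler_weXn2l.
- by rewrite lef_pV2 ?posrE ?mulr_gt0 // ler_peMr ?(ltW lj0) // exprn_ege1.
Qed.
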